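(* Let $\mathcal G$ be a $\Gamma$-periodic graph in $\mathbb R^d$ with fixed (possibly equal) vertices $v_1,v_2\in\mathcal V\cap\Omega$, and let $Q$ be a real periodic potential given by a vector $(Q_v)_{v\in\mathcal V_*}\in\mathbb R^\nu$, $\nu=\#\mathcal V_*$. For $t\in\mathbb Z^d$ let $\mathcal G_t$ be the perturbed graph and let $\widetilde{\mathcal G}$ be its limit graph. Then $\mathcal G_t$ is asymptotically isospectral to $\widetilde{\mathcal G}$ as $|t|\to\infty$, i.e. $$\widetilde\lambda_j^-=\lim_{|t|\to\infty}\lambda_j^-(t),\qquad \widetilde\lambda_j^+=\lim_{|t|\to\infty}\lambda_j^+(t),\qquad \forall\, j\in\{1,\ldots,\nu\},$$ where $\widetilde\lambda_j^\pm$ and $\lambda_j^\pm(t)$ are the band edges of the Schrödinger operators $H_{\widetilde{\mathcal G}}=\Delta_{\widetilde{\mathcal G}}+Q$ on $\widetilde{\mathcal G}$ and $H_{\mathcal G_t}=\Delta_{\mathcal G_t}+Q$ on $\mathcal G_t$, respectively.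
   Context: **Periodic graphs.** Let $\Gamma$ be a lattice of rank $d$ in $\mathbb R^d$ with basis $\mathfrak a_1,\ldots,\mathfrak a_d$ and fundamental cell $\Omega=\{\sum_{s=1}^d x_s\mathfrak a_s: x_s\in[0,1)\}$. A $\Gamma$-periodic graph $\mathcal G=(\mathcal V,\mathcal E)$ is a connected infinite locally finite graph embedded in $\mathbb R^d$ (loops and multiple edges allowed) that is invariant under translation by every vector of $\Gamma$ and whose quotient $\mathcal G_*=\mathcal G/\Gamma=(\mathcal V_*,\mathcal E_* )$ (the fundamental graph) is finite. Vertices of $\mathcal G_*$ are identified with the vertices in $\mathcal V\cap\Omega$. Each unoriented edge (also each loop) gives two oriented edges $\mathbf e$ and $\overline{\mathbf e}$ (mutually inverse); $\mathcal A$ and $\mathcal A_*=\mathcal A/\Gamma$ are the sets of oriented edges of $\mathcal G$ and $\mathcal G_*$. **Edge indices.** Every $v\in\mathcal V$ is uniquely $v=v_0+[v]$ with $v_0\in\mathcal V\cap\Omega$, $[v]\in\Gamma$. The index of an oriented edge $\mathbf e=(u,v)\in\mathcal A$ is the vector $\tau(\mathbf e)\in\mathbb Z^d$ of coordinates of $[v]-[u]$ in the basis $\mathfrak a_1,\ldots,\mathfrak a_d$. It is $\Gamma$-invariant, so it defines $\tau(\mathbf e)$ for $\mathbf e\in\mathcal A_*$; moreover $\tau(\overline{\mathbf e})=-\tau(\mathbf e)$. **Schrödinger operators and band edges.** For a $\Gamma$-periodic potential $Q:\mathcal V\to\mathbb R$ (determined by $(Q_v)_{v\in\mathcal V_*}$),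 $H=\Delta+Q$ acts on $\ell^2(\mathcal V)$ by $(\Delta f)_v=\sum_{(v,u)\in\mathcal A}(f_v-f_u)$, $(Qf)_v=Q_vf_v$. With $\mathbb T^d=(-\pi,\pi]^d=\mathbb R^d/2\pi\mathbb Z^d$, the fiber operators on $\ell^2(\mathcal V_* )=\mathbb C^\nu$, $\nu=\#\mathcal V_*$, are $H(k)=\Delta(k)+Q$, $(\Delta(k)f)_v=\sum_{\mathbf e=(v,u)\in\mathcal A_*}(f_v-e^{i\langle\tau(\mathbf e),k\rangle}f_u)$. The eigenvalues $\lambda_1(k)\le\ldots\le\lambda_\nu(k)$ of $H(k)$, counted with multiplicity, are the band functions; the band edges are $\lambda_j^-=\min_{k\in\mathbb T^d}\lambda_j(k)$, $\lambda_j^+=\max_{k\in\mathbb T^d}\lambda_j(k)$, and $\sigma(H)=\bigcup_{j=1}^\nu[\lambda_j^-,\lambda_j^+]$. The same definitions apply to periodic graphs in any dimension. **Perturbed graph.** For $t=(t_1,\ldots,t_d)\in\mathbb Z^d$, $\mathcal G_t$ is the $\Gamma$-periodic graph obtained from $\mathcal G$ (same vertex set) by adding the edges $\mathbf e_o+\mathfrak a$, $\mathfrak a\in\Gamma$, where $\mathbf e_o=(v_1,v_2+t_1\mathfrak a_1+\ldots+t_d\mathfrak a_d)$. Its fundamental graph is $(\mathcal V_*,\mathcal E_*\cup\{\mathbf e_o\})$, the added edge $\mathbf e_o=(v_1,v_2)$ having index $t$. Its band edges are denoted $\lambda_j^\pm(t)$. **Limit graph.** Complete $\mathfrak a_1,\ldots,\mathfrak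 a_d$ (with $\mathbb R^d$ viewed as $\mathbb R^d\times\{0\}\subset\mathbb R^{d+1}$) by a vector $\mathfrak a_{d+1}$ to a basis of $\mathbb R^{d+1}$, and let $\widetilde\Gamma$ be the lattice with basis $\mathfrak a_1,\ldots,\mathfrak a_{d+1}$. The limit graph $\widetilde{\mathcal G}$ is the $\widetilde\Gamma$-periodic graph consisting of the copies $\mathcal G+n\mathfrak a_{d+1}$, $n\in\mathbb Z$, together with the edges $\mathbf e_o+\mathfrak a$, $\mathfrak a\in\widetilde\Gamma$, where $\mathbf e_o=(v_1,v_2+\mathfrak a_{d+1})$. Its fundamental graph is also $(\mathcal V_*,\mathcal E_*\cup\{\mathbf e_o\})$; with respect to $\widetilde\Gamma$, the edges of $\mathcal A_*$ have indices $(\tau(\mathbf e),0)\in\mathbb Z^{d+1}$ and $\mathbf e_o$ has index $(0,\ldots,0,1)$. The potential on $\widetilde{\mathcal G}$ is the $\widetilde\Gamma$-periodic potential given by the same vector $(Q_v)_{v\in\mathcal V_*}$. The band functions of $H_{\widetilde{\mathcal G}}$ on $\mathbb T^{d+1}$ are denoted $\widetilde\lambda_j(\cdot)$, and its band edges $\widetilde\lambda_j^\pm$. $|\cdot|$ is the Euclidean norm. *)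

(* Defs.v *)
From HB Require Import structures.
From mathcomp Require Import all_boot all_order all_algebra.
From mathcomp Require Import all_classical all_reals all_analysis.
From mathcomp Require Import finmap complex.

Set Implicit Arguments.
Unset Strict Implicit.
Unset Printing Implicit Defensive.

Import Order.TTheory GRing.Theory Num.Theory.
Import numFieldNormedType.Exports.

Local Open Scope classical_set_scope.
Local Open Scope ring_scope.

(* [edge] is the type of ORIENTED edges; [erev] reverses the orientation.  The
   rows of [basis] are the lattice vectors a_1, ..., a_d, and [eshift m] is the
   translation of edges by m_1 a_1 + ... + m_d a_d (parallel edges are not
   determined by their endpoints, so it cannot be read off from them).  Crossings
   of edges are irrelevant, so the embedding is just the position of vertices. *)
Record latgraph (R : realType) (d : nat) := LatGraph {
  basis : 'M[R]_d;
  vert : set 'rV[R]_d;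
  edge : choiceType;
  src : edge -> 'rV[R]_d;
  tgt : edge -> 'rV[R]_d;
  erev : edge -> edge;
  eshift : 'rV[int]_d -> edge -> edge
}.

Section LatticeGraph.
Variables (R : realType) (d : nat) (G : latgraph R d).

Definition lvec (m : 'rV[int]_d) : 'rV[R]_d :=
  map_mx (fun z : int => z%:~R) m *m basis G.

Definition coords (x : 'rV[R]_d) : 'rV[R]_d := x *m invmx (basis G).

Definition cell : set 'rV[R]_d :=
  [set x | forall s : 'I_d, 0 <= coords x 0 s < 1].

(* The decomposition x = x_0 + [x], with x_0 in the cell and [x] in the lattice:
   [intpart x] is the coordinate vector of [x], and [cellpart x] is x_0. *)
Definition intpart (x : 'rV[R]_d) : 'rV[int]_d :=
  map_mx (fun y : R => Num.floor y) (coords x).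

Definition cellpart (x : 'rV[R]_d) : 'rV[R]_d := x - lvec (intpart x).

Definition fund_vert : set 'rV[R]_d := vert G `&` cell.

(* The action on edges is free, and every orbit of oriented edges contains
   exactly one edge starting in the cell: this set represents A_*. *)
Definition fund_edge : set (edge G) := [set e | cell (src e)].

Definition edge_index (e : edge G) : 'rV[int]_d :=
  intpart (tgt e) - intpart (src e).

Fixpoint walk (x : 'rV[R]_d) (p : seq (edge G)) (y : 'rV[R]_d) : Prop :=
  if p is e :: p' then src e = x /\ walk (tgt e) p' y else x = y.

Record periodic_graph : Prop := PeriodicGraph {
  pg_basis : basis G \in unitmx;
  pg_src : forall e : edge G, vert G (src e);
  pg_revK : involutive (@erev _ _ G);
  pg_rev_neq : forall e : edge G, erev e <> e;
  pg_src_rev : forall e : edge G, src (erev e) = tgt e;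
  pg_vert_shift : forall m x, vert G x -> vert G (x + lvec m);
  pg_shift0 : forall e : edge G, eshift 0 e = e;
  pg_shiftD : forall m n (e : edge G), eshift (m + n) e = eshift m (eshift n e);
  pg_shift_rev : forall m (e : edge G), eshift m (erev e) = erev (eshift m e);
  pg_src_shift : forall m (e : edge G), src (eshift m e) = src e + lvec m;
  pg_infinite : infinite_set (vert G);
  pg_locally_finite :
    forall x, vert G x -> finite_set [set e : edge G | src e = x];
  pg_connected :
    forall x y, vert G x -> vert G y -> exists p, walk x p y;
  pg_fund_vert : finite_set fund_vert;
  pg_fund_edge : finite_set fund_edge
}.

Definition periodic_potential (Q : 'rV[R]_d -> R) : Prop :=
  forall m x, vert G x -> Q (x + lvec m) = Q x.

Definition nu : nat := (#|` fset_set fund_vert|)%fset.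

Definition vtx (i : 'I_nu) : 'rV[R]_d := nth 0 (fset_set fund_vert) i.

Definition index_phase (e : edge G) (k : 'rV[R]_d) : R :=
  \sum_(s < d) (edge_index e 0 s)%:~R * k 0 s.

Definition expi (x : R) : R[i] := (cos x +i* sin x)%C.

(* [cellpart (tgt e)] is the terminal vertex of e in the fundamental graph. *)
Definition fiber_laplacian (k : 'rV[R]_d) (f : 'rV[R]_d -> R[i])
    (v : 'rV[R]_d) : R[i] :=
  \sum_(e \in [set e | fund_edge e /\ src e = v])
     (f v - expi (index_phase e k) * f (cellpart (tgt e))).

Definition fiber_schrodinger (Q : 'rV[R]_d -> R) (k : 'rV[R]_d)
    (f : 'rV[R]_d -> R[i]) (v : 'rV[R]_d) : R[i] :=
  fiber_laplacian k f v + (Q v)%:C%C * f v.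

Definition fiber_mx (Q : 'rV[R]_d -> R) (k : 'rV[R]_d) : 'M[R[i]]_nu :=
  \matrix_(i, j)
    fiber_schrodinger Q k (fun v => if v == vtx j then 1 else 0) (vtx i).

End LatticeGraph.

(* The roots of the characteristic polynomial, with multiplicity, in increasing
   order; meant for Hermitian matrices, whose eigenvalues are real. *)
Definition eigenvalues (R : realType) (n : nat) (M : 'M[R[i]]_n) : seq R :=
  sort <=%R
    [seq complex.Re z | z <- sval (closed_field_poly_normal (char_poly M))].

Definition torus (R : realType) (d : nat) : set 'rV[R]_d :=
  [set k | forall s : 'I_d, - pi < k 0 s <= pi].
Arguments torus : clear implicits.

(* The junk value 0 is never reached for band functions: they are continuous and
   2 pi Z^d-periodic, so that both extrema are attained. *)
Definition min_on (R : realType) (T : Type) (A : set T) (f : T -> R) : R :=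
  xget 0 [set m | (f @` A) m /\ forall x, A x -> m <= f x].

Definition max_on (R : realType) (T : Type) (A : set T) (f : T -> R) : R :=
  xget 0 [set m | (f @` A) m /\ forall x, A x -> f x <= m].

(* Band functions are numbered from 1 to [nu G]. *)
Definition band (R : realType) (d : nat) (G : latgraph R d)
    (Q : 'rV[R]_d -> R) (j : nat) (k : 'rV[R]_d) : R :=
  nth 0 (eigenvalues (fiber_mx G Q k)) j.-1.

Definition band_min (R : realType) (d : nat) (G : latgraph R d)
    (Q : 'rV[R]_d -> R) (j : nat) : R :=
  min_on (torus R d) (band G Q j).

Definition band_max (R : realType) (d : nat) (G : latgraph R d)
    (Q : 'rV[R]_d -> R) (j : nat) : R :=
  max_on (torus R d) (band G Q j).

(* The oriented edge [inr (m, b)] is the translate by m of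
    e_o = (v1, v2 + t) if b = false, and of its reverse if b = true. *)
Section Perturbed.
Variables (R : realType) (d : nat) (G : latgraph R d).
Variables (v1 v2 : 'rV[R]_d) (t : 'rV[int]_d).

Let pedge : choiceType := (edge G + 'rV[int]_d * bool)%type.

Definition pert_end (m : 'rV[int]_d) (b : bool) : 'rV[R]_d :=
  (if b then v2 + lvec G t else v1) + lvec G m.

Definition perturbed : latgraph R d :=
  @LatGraph R d (basis G) (vert G) pedge
    (fun e : pedge => match e with
                      | inl e0 => src e0
                      | inr (m, b) => pert_end m b
                      end)
    (fun e : pedge => match e with
                      | inl e0 => tgt e0
                      | inr (m, b) => pert_end m (~~ b)
                      end)
    (fun e : pedge => match e with
                      | inl e0 => inl (erev e0)
                      | inr (m, b) => inr (m, ~~ b)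
                      end)
    (fun n (e : pedge) => match e with
                          | inl e0 => inl (eshift n e0)
                          | inr (m, b) => inr (n + m, b)
                          end).

End Perturbed.

(* Here a completes the basis of G to a basis of R^(d+1); the
    oriented edge [inl (e, n)] is the copy of e in G + n a, and [inr (m, b)] is
    the translate by m of e_o = (v1, v2 + a) (b = false) or of its reverse. *)
Section Limit.
Variables (R : realType) (d : nat) (G : latgraph R d).
Variables (v1 v2 : 'rV[R]_d) (a : 'rV[R]_(d + 1)).

Let ledge : choiceType := (edge G * int + 'rV[int]_(d + 1) * bool)%type.

Definition emb (x : 'rV[R]_d) : 'rV[R]_(d + 1) := row_mx x 0.

Definition limit_basis : 'M[R]_(d + 1) := col_mx (row_mx (basis G) 0) a.

Definition layer (x : 'rV[R]_d) (n : int) : 'rV[R]_(d + 1) :=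
  emb x + n%:~R *: a.

Definition limit_end (m : 'rV[int]_(d + 1)) (b : bool) : 'rV[R]_(d + 1) :=
  (if b then emb v2 + a else emb v1)
  + map_mx (fun z : int => z%:~R) m *m limit_basis.

Definition limit_graph : latgraph R (d + 1) :=
  @LatGraph R (d + 1) limit_basis
    [set y | exists x n, vert G x /\ y = layer x n]
    ledge
    (fun e : ledge => match e with
                      | inl (e0, n) => layer (src e0) n
                      | inr (m, b) => limit_end m b
                      end)
    (fun e : ledge => match e with
                      | inl (e0, n) => layer (tgt e0) n
                      | inr (m, b) => limit_end m (~~ b)
                      end)
    (fun e : ledge => match e with
                      | inl (e0, n) => inl (erev e0, n)
                      | inr (m, b) => inr (m, ~~ b)
                      end)
    (fun p (e : ledge) => match e with
                          | inl (e0, n) =>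
                              inl (eshift (lsubmx p) e0, rsubmx p 0 0 + n)
                          | inr (m, b) => inr (p + m, b)
                          end).

End Limit.

Definition enorm (R : realType) (d : nat) (t : 'rV[int]_d) : R :=
  Num.sqrt (\sum_(s < d) (t 0 s)%:~R ^+ 2).

Definition at_infty (R : realType) (d : nat) : set_system 'rV[int]_d :=
  filter_from [set: R] (fun M => [set t | M < enorm R t]).
Arguments at_infty : clear implicits.

(* Main.v *)
(* Adding an edge orbit of index t multiplies the hopping between v1 and v2 by
   exp(i <t, k>).  Replacing <t, k> by an independent phase theta gives a Hermitian
   matrix M(k, theta), which is the fiber matrix of the limit graph, while the
   fiber matrix of G_t at k is M(k, <t, k>).  So the bands of G_t are restrictions
   of the bands of the limit graph to the windings k |-> (k, <t, k>) of the
   (d+1)-torus.  If some |t_s| is large, moving k_s by at most pi / |t_s| brings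
   <t, k> to any prescribed phase: the windings become dense, and continuity of the
   ordered eigenvalues (Weyl) gives the convergence of the extrema. *)
Require Import Defs.
From HB Require Import structures.
From mathcomp Require Import all_boot all_order all_algebra.
From mathcomp Require Import all_classical all_reals all_analysis.
From mathcomp Require Import finmap complex perm spectral sesquilinear ring lra.
Import Order.TTheory GRing.Theory Num.Theory.
Import numFieldNormedType.Exports.
Local Open Scope classical_set_scope.
Local Open Scope ring_scope.

Set Implicit Arguments.
Unset Strict Implicit.
Unset Printing Implicit Defensive.

(** * Eigenvalues of Hermitian matrices *)

Section Weyl.
Local Open Scope sesquilinear_scope.
Variable (C : numClosedFieldType) (n : nat).
Implicit Types (A B P : 'M[C]_n) (v w : 'rV[C]_n) (I J : {set 'I_n}).

Lemma rank_rowsub_unitary P I : P \is unitarymx ->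
  \rank (rowsub (@enum_val _ (mem I)) P) = #|I|.
Proof.
move=> /row_unitarymxP Pu; apply: mxrank_unitary; apply/row_unitarymxP => i j.
by rewrite !row_rowsub Pu (inj_eq enum_val_inj).
Qed.

(** The entries of [v *m P^t*] are the coordinates of [v] in the orthonormal basis formed by the
    rows of [P]. *)
Lemma rowsub_unitary_coord P I v i : P \is unitarymx -> i \notin I ->
  (v <= rowsub (@enum_val _ (mem I)) P)%MS -> (v *m P^t*) 0 i = 0.
Proof.
move=> Pu iI /submxP[u ->].
rewrite -mulmxA -[P in rowsub _ P]mul1mx -mul_rowsub_mx -mulmxA.
move/unitarymxP: Pu => ->; rewrite mulmx1 mxE big1// => k _.
rewrite !mxE; case: eqVneq => [ki|]; last by rewrite mulr0.
by move: iI; rewrite -ki enum_valP.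
Qed.

Lemma unitary_form v P : P \is unitarymx ->
  (v *m v^t*) 0 0 = \sum_i `|(v *m P^t*) 0 i| ^+ 2.
Proof.
move=> Pu; transitivity ((v *m P^t* *m (v *m P^t*)^t*) 0 0).
  rewrite trmx_mul map_mxM trmxCK mulmxA mulmxKtV//.
by rewrite mxE; apply: eq_bigr => i _; rewrite !mxE -normCK.
Qed.

Lemma spectral_form A v : A \is hermsymmx ->
  (v *m A *m v^t*) 0 0 =
  \sum_i spectral_diag A 0 i * `|(v *m (spectralmx A)^t*) 0 i| ^+ 2.
Proof.
move=> /hermitian_normalmx/orthomx_spectralP {1}->.
rewrite invmx_unitary ?spectral_unitarymx//.
set P := spectralmx A; set D := spectral_diag A.
transitivity ((v *m P^t* *m diag_mx D *m (v *m P^t*)^t*) 0 0).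
  by rewrite trmx_mul map_mxM trmxCK !mulmxA.
move: (v *m P^t*) => w; rewrite mxE; apply: eq_bigr => i _.
by rewrite mul_mx_diag !mxE mulrAC -normCK mulrC.
Qed.

(* Courant-Fischer by dimension count: the eigenvectors of A indexed by I and
   those of B indexed by J span spaces that share a nonzero vector. *)
Lemma spectral_compare A B I J (a b e : C) :
  A \is hermsymmx -> B \is hermsymmx -> (n < #|I| + #|J|)%N ->
  (forall i, i \in I -> a <= spectral_diag A 0 i) ->
  (forall i, i \in J -> spectral_diag B 0 i <= b) ->
  (forall v, (v *m (A - B) *m v^t*) 0 0 <= e * (v *m v^t*) 0 0) ->
  a <= b + e.
Proof.
move=> hA hB nIJ aI Jb ABe.
have uA := spectral_unitarymx A; have uB := spectral_unitarymx B.
pose U := rowsub (@enum_val _ (mem I)) (spectralmx A).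
pose V := rowsub (@enum_val _ (mem J)) (spectralmx B).
have UV0 : (U :&: V)%MS != 0.
  apply: contraL nIJ => /eqP UV0; rewrite -leqNgt.
  rewrite -(rank_rowsub_unitary I uA) -(rank_rowsub_unitary J uB).
  by rewrite -mxrank_sum_cap -/U -/V UV0 mxrank0 addn0 rank_leq_col.
pose v := nz_row (U :&: V)%MS.
have v0 : v != 0 by rewrite nz_row_eq0.
have /andP[vU vV] : (v <= U)%MS && (v <= V)%MS by rewrite -sub_capmx nz_row_sub.
have nv : 0 < (v *m v^t*) 0 0.
  rewrite (_ : (v *m v^t*) 0 0 = \sum_i `|v 0 i| ^+ 2); last first.
    by rewrite mxE; apply: eq_bigr => i _; rewrite !mxE -normCK.
  rewrite lt_def sumr_ge0 ?andbT => [|i _]; last by rewrite exprn_ge0.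
  apply: contra v0 => /eqP/psumr_eq0P h; apply/eqP/rowP => i.
  apply/eqP; rewrite mxE -normr_eq0 -sqrf_eq0 h//.
(* Multiply by |v|^2 > 0. As [v] lies in both spans, its form under [A] is at least a |v|^2 and its
   form under [B] at most b |v|^2; the difference of the two forms is bounded by [ABe]. *)
rewrite -(ler_pM2r nv) mulrDl -lerBlDl; apply: le_trans (ABe v).
rewrite mulmxBr mulmxBl [leRHS]mxE [X in _ <= _ + X]mxE lerB//.
  rewrite (spectral_form _ hA) (unitary_form _ uA) mulr_sumr.
  apply: ler_sum => i _; have [/aI ai|iI] := boolP (i \in I).
    by rewrite ler_wpM2r// exprn_ge0.
  by rewrite (rowsub_unitary_coord uA iI vU) normr0 expr0n/= !mulr0.
rewrite (spectral_form _ hB) (unitary_form _ uB) mulr_sumr.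
apply: ler_sum => i _; have [/Jb ai|iI] := boolP (i \in J).
  by rewrite ler_wpM2r// exprn_ge0.
by rewrite (rowsub_unitary_coord uB iI vV) normr0 expr0n/= !mulr0.
Qed.

Lemma char_poly_spectral A : A \is hermsymmx ->
  char_poly A = \prod_(i < n) ('X - (spectral_diag A 0 i)%:P).
Proof.
move=> /hermitian_normalmx/orthomx_spectralP {1}->.
set D := diag_mx _; have Pu := spectral_unit A.
rewrite /char_poly /char_poly_mx.
transitivity (\det (map_mx polyC (invmx (spectralmx A)) *m
    ('X%:M - map_mx polyC D) *m map_mx polyC (spectralmx A))).
  congr (\det _); rewrite mulmxBr mulmxBl -!map_mxM; congr (_ - _).
  by rewrite scalar_mxC -mulmxA -map_mxM mulVmx// map_mx1 mulmx1.
rewrite !det_mulmx mulrAC -det_mulmx -map_mxM mulVmx// map_mx1 det1 mul1r.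
rewrite (_ : _ - _ = diag_mx (\row_i ('X - (spectral_diag A 0 i)%:P))).
  by rewrite det_diag; apply: eq_bigr => i _; rewrite mxE.
by apply/matrixP => i j; rewrite !mxE rmorphMn/= -mulrnBl.
Qed.

End Weyl.

(** * Weyl's inequality for ordered eigenvalues *)

Section Eigenvalues.
Local Open Scope sesquilinear_scope.
Variable R : realType.

(** Rows and columns are permuted alike, so the two signs cancel. The sizes are kept distinct
    because the numbers of fundamental vertices of two graphs are equal only propositionally. *)
Lemma char_poly_conj_reindex (S : comNzRingType) (m n : nat) (A : 'M[S]_m) (B : 'M[S]_n)
    (f : 'I_m -> 'I_n) :
  bijective f -> (forall i j, A i j = B (f i) (f j)) ->
  char_poly A = char_poly B.
Proof.
move=> bf AB.
have mn : m = n by rewrite -(card_ord m) (bij_eq_card bf) card_ord.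
move: A f bf AB; rewrite mn => A f /bij_inj fI AB.
rewrite /char_poly.
have -> : char_poly_mx A = row_perm (perm fI) (col_perm (perm fI) (char_poly_mx B)).
  by apply/matrixP => i j; rewrite !mxE !permE AB (inj_eq fI).
rewrite row_permE col_permE !det_mulmx !det_perm.
rewrite mulrCA mulrA odd_permV -mulrA -signr_addb addbb mulr1.
by [].
Qed.

Lemma eq_eigenvalues (m n : nat) (A : 'M[R[i]]_m) (B : 'M[R[i]]_n) :
  char_poly A = char_poly B -> eigenvalues A = eigenvalues B.
Proof. by rewrite /eigenvalues => ->. Qed.

Variable n : nat.
Implicit Types A B : 'M[R[i]]_n.

(** Links the two descriptions of the spectrum: [eigenvalues] comes from the roots of the
    characteristic polynomial, whereas the variational argument works with [spectral_diag]. *)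
Lemma perm_eigenvalues A : A \is hermsymmx ->
  perm_eq (eigenvalues A)
    [seq complex.Re (spectral_diag A 0 i) | i <- enum 'I_n].
Proof.
move=> hA; rewrite perm_sort.
rewrite [X in perm_eq _ X](map_comp (@complex.Re R) (spectral_diag A 0)).
apply: perm_map; apply: prod_XsubC_eq; rewrite big_map big_enum/=.
rewrite -char_poly_spectral//; case: closed_field_poly_normal => r /= rE.
by rewrite [RHS]rE (monicP (char_poly_monic A)) scale1r.
Qed.

Lemma size_eigenvalues A : A \is hermsymmx -> size (eigenvalues A) = n.
Proof.
by move=> /perm_eigenvalues/perm_size->; rewrite size_map size_enum_ord.
Qed.

Lemma count_eigenvalues A (p : pred R) : A \is hermsymmx ->
  count p (eigenvalues A) = #|[set i | p (complex.Re (spectral_diag A 0 i))]%SET|.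
Proof.
move=> /perm_eigenvalues/seq.permP->; rewrite count_map -sum1_count -sum1_card.
by rewrite big_enum_cond/=; apply: eq_bigl => i; rewrite inE.
Qed.

(** With indices starting at 0, at least n - j eigenvalues of [A] are above its j-th one and at
    least j + 1 eigenvalues of [B] are below its j-th one. These counts add up to n + 1, just enough
    for [spectral_compare]. *)
Lemma eigenvalue_le A B j (e : R) : A \is hermsymmx -> B \is hermsymmx ->
  (j < n)%N ->
  (forall v : 'rV[R[i]]_n, (v *m (A - B) *m v^t*) 0 0 <= e%:C%C * (v *m v^t*) 0 0) ->
  nth 0 (eigenvalues A) j <= nth 0 (eigenvalues B) j + e.
Proof.
move=> hA hB jn ABe.
have sA := size_eigenvalues hA; have sB := size_eigenvalues hB.
have srt (M : 'M[R[i]]_n) : sorted <=%R (eigenvalues M).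
  exact: (sort_sorted le_total).
rewrite -lecR rmorphD/=.
set a := nth 0 (eigenvalues A) j; set b := nth 0 (eigenvalues B) j.
apply: (@spectral_compare _ _ A B
   [set i | a <= complex.Re (spectral_diag A 0 i)]%SET
   [set i | complex.Re (spectral_diag B 0 i) <= b]%SET) => //.
- rewrite -(count_eigenvalues (fun x : R => (a <= x)%R) hA).
  rewrite -(count_eigenvalues (fun x : R => (x <= b)%R) hB).
  have h1 : (n - j <= count (fun x : R => (a <= x)%R) (eigenvalues A))%N.
    rewrite -(cat_take_drop j (eigenvalues A)) count_cat.
    apply: leq_trans (leq_addl _ _).
    suff /[!all_count]/eqP-> : all (fun x : R => (a <= x)%R) (drop j (eigenvalues A)).
      by rewrite size_drop sA.
    apply/(all_nthP 0) => i.
    rewrite size_drop sA => ij; rewrite nth_drop.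
    by apply: le_sorted_leq_nth (leq_addr _ _); rewrite ?inE ?sA// -ltn_subRL.
  have h2 : (j.+1 <= count (fun x : R => (x <= b)%R) (eigenvalues B))%N.
    rewrite -(cat_take_drop j.+1 (eigenvalues B)) count_cat.
    apply: leq_trans (leq_addr _ _).
    have sz : size (take j.+1 (eigenvalues B)) = j.+1 by rewrite size_takel// sB.
    suff /[!all_count]/eqP-> : all (fun x : R => (x <= b)%R) (take j.+1 (eigenvalues B)).
      by rewrite sz.
    apply/(all_nthP 0) => i.
    rewrite sz => ij; rewrite nth_take//.
    apply: le_sorted_leq_nth => //; rewrite ?inE ?sB//.
    by apply: leq_trans jn.
  by apply: leq_trans (leq_add h1 h2); rewrite addnS ltnS subnK// ltnW.
- move=> i; rewrite inE -lecR RRe_real//.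
  by have /mxOverP := hermitian_spectral_diag_real hA; apply.
- move=> i; rewrite inE -lecR RRe_real//.
  by have /mxOverP := hermitian_spectral_diag_real hB; apply.
Qed.

(** Each of the n^2 terms of the form is at most e (|v_i|^2 + |v_j|^2) / 2 by the inequality of
    means; summing over i and j produces the factor n. *)
Lemma hermitian_form_le A B (e : R) : A \is hermsymmx -> B \is hermsymmx ->
  (forall i j, `|A i j - B i j| <= e%:C%C) ->
  forall v : 'rV[R[i]]_n,
  (v *m (A - B) *m v^t*) 0 0 <= (n%:R * e)%:C%C * (v *m v^t*) 0 0.
Proof.
move=> hA hB ABe v.
have formR (M : 'M[R[i]]_n) : M \is hermsymmx -> (v *m M *m v^t*) 0 0 \is Num.real.
  move=> hM; rewrite spectral_form// rpred_sum// => i _.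
  rewrite rpredM// ?rpredX ?normr_real//.
  by have /mxOverP := hermitian_spectral_diag_real hM; apply.
(* The order on [R[i]] only compares numbers whose difference is real, so the form must be known to
   be real before it is bounded by its modulus. *)
have fR : (v *m (A - B) *m v^t*) 0 0 \is Num.real.
  rewrite mulmxBr mulmxBl !mxE rpredB// -?mxE.
    by move: (formR _ hA); rewrite mxE.
  by move: (formR _ hB); rewrite mxE.
apply: le_trans (real_ler_norm fR) _; rewrite mxE.
have -> : (v *m v^t*) 0 0 = \sum_i `|v 0 i| ^+ 2.
  by rewrite mxE; apply: eq_bigr => i _; rewrite !mxE -normCK.
have step j i : `|v 0 j * (A - B) j i * (v^t*) i 0| <=
    e%:C%C * ((`|v 0 i| ^+ 2 + `|v 0 j| ^+ 2) / 2).
  rewrite !mxE !normrM norm_conjC mulrAC mulrC ler_pM ?mulr_ge0//.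
  by rewrite mulrC (real_leif_mean_square (normr_real _) (normr_real _)).
apply: (@le_trans _ _ (\sum_i \sum_j e%:C%C * ((`|v 0 i| ^+ 2 + `|v 0 j| ^+ 2) / 2))).
  apply: le_trans (ler_norm_sum _ _ _) _; apply: ler_sum => i _.
  rewrite mxE mulr_suml; apply: le_trans (ler_norm_sum _ _ _) _.
  by apply: ler_sum => j _; exact: step.
under eq_bigr do rewrite -mulr_sumr -mulr_suml big_split/= sumr_const card_ord.
rewrite -mulr_sumr -mulr_suml big_split/= sumr_const card_ord sumrMnl.
rewrite -mulr2n -[X in X / 2]mulr_natr mulfK ?pnatr_eq0// rmorphM/= rmorph_nat.
by rewrite mulrnAr -mulrA mulr_natl.
Qed.

Lemma eigenvalue_dist A B j (e : R) : A \is hermsymmx -> B \is hermsymmx ->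
  0 <= e -> (forall i j, `|A i j - B i j| <= e%:C%C) ->
  `|nth 0 (eigenvalues A) j - nth 0 (eigenvalues B) j| <= n%:R * e.
Proof.
(* For j out of range both [nth] return the default 0. *)
move=> hA hB e0 ABe; have [jn|nj] := ltnP j n; last first.
  by rewrite !nth_default ?size_eigenvalues// subrr normr0 mulr_ge0.
rewrite ler_norml lerBlDl (eigenvalue_le hA hB jn) ?andbT; last exact: hermitian_form_le.
rewrite lerNl opprB lerBlDl (eigenvalue_le hB hA jn)//.
apply: hermitian_form_le => // i k.
by rewrite distrC.
Qed.

End Eigenvalues.

(** * Periodic functions on the torus *)

Section Torus.
Variable R : realType.

Definition pshift (n : nat) (m : 'rV[int]_n) : 'rV[R]_n :=
  map_mx (fun z : int => pi *+ 2 * z%:~R) m.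

Definition torus_periodic (n : nat) (T : Type) (F : 'rV[R]_n -> T) :=
  forall m x, F (x + pshift m) = F x.

(** The interval is open on the left and closed on the right, hence a ceiling and not a floor. *)
Lemma angle_rep (x : R) : exists z : int, - pi < x + pi *+ 2 * z%:~R <= pi.
Proof.
have p0 : 0 < pi *+ 2 :> R by rewrite mulrn_wgt0// pi_gt0.
have := ceil_itv ((x - pi) / (pi *+ 2)); set c := Num.ceil _.
rewrite intrB ltr_pdivlMr// ler_pdivrMr// => /andP[h1 h2].
by exists (- c); rewrite mulrNz; apply/andP; split; move: h1 h2; set y := c%:~R; nra.
Qed.

Lemma torus_rep n (x : 'rV[R]_n) : exists m, torus R n (x + pshift m).
Proof.
have /choice[z zP] (i : 'I_n) := angle_rep (x 0 i).
by exists (\row_i z i) => i; rewrite !mxE.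
Qed.

(** The half-open box [torus] is not compact: minimise over its closure, then bring the minimiser
    back into [torus] by periodicity. *)
Lemma periodic_min n (F : 'rV[R]_n -> R) : continuous F -> torus_periodic F ->
  exists2 c, torus R n c & forall x, F c <= F x.
Proof.
move=> cF pF; pose K := [set v : 'rV[R]_n | forall i, `[- pi, pi]%classic (v ord0 i)].
have cK : compact K by apply: (@rV_compact R n (fun=> `[- pi, pi]%classic)) => i;
  exact: segment_compact.
have TK x : torus R n x -> K x.
  by move=> Tx i /=; rewrite in_itv/=; case/andP: (Tx i) => /ltW-> ->.
have [|c Kc cmin] := EVT_min_rV _ cK (continuous_subspaceT cF).
  by have [m /TK] := torus_rep (0 : 'rV[R]_n); eexists; eassumption.
have [m Tc] := torus_rep c; exists (c + pshift m) => // x.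
by have [k /TK/mem_set/cmin] := torus_rep x; rewrite !pF.
Qed.

Lemma min_onE (T : Type) (A : set T) (f : T -> R) c : A c ->
  (forall x, A x -> f c <= f x) -> min_on A f = f c.
Proof.
move=> Ac cmin; apply: xget_unique => [|y [[x Ax <-] fx]].
  by split => //; exists c.
by apply/le_anti; rewrite fx// cmin.
Qed.

Lemma max_onE (T : Type) (A : set T) (f : T -> R) c : A c ->
  (forall x, A x -> f x <= f c) -> max_on A f = f c.
Proof.
move=> Ac cmin; apply: xget_unique => [|y [[x Ax <-] fx]].
  by split => //; exists c.
by apply/le_anti; rewrite fx// cmin.
Qed.

(** Lets the convergence of maxima be deduced from that of minima. *)
Lemma max_on_torus n (F : 'rV[R]_n -> R) : continuous F -> torus_periodic F ->
  max_on (torus R n) F = - min_on (torus R n) (- F).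
Proof.
move=> cF pF; have [|m x|c Tc cmin] := @periodic_min n (- F).
- by move=> x; exact: cvgN (cF x).
- by rewrite !fctE pF.
rewrite (min_onE Tc)// (max_onE Tc) => [|x _]; first by rewrite opprK.
by have := cmin x; rewrite !fctE lerN2.
Qed.

Lemma sum_continuous (T : topologicalType) (I : Type) (r : seq I)
    (f : I -> T -> R) :
  (forall i, continuous (f i)) -> continuous (fun x => \sum_(i <- r) f i x).
Proof.
by move=> cf; apply: continuous_big => [|i _]; [exact: add_continuous|exact: cf].
Qed.

Lemma scaled_coord_continuous d (a : R) (s : 'I_d) :
  continuous (fun k : 'rV[R]_d => a * k 0 s).
Proof.
move=> k; apply: (@continuousM _ _ (cst a) (fun k : 'rV[R]_d => k 0 s)).
  exact: cst_continuous.
exact: coord_continuous.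
Qed.

(** * Windings of the (d+1)-torus *)

Definition winding d (t : 'rV[int]_d) (k : 'rV[R]_d) : 'rV[R]_(d + 1) :=
  row_mx k (const_mx (\sum_s (t 0 s)%:~R * k 0 s)).

Lemma winding_continuous d (t : 'rV[int]_d) : continuous (winding t).
Proof.
have cW (j : 'I_(d + 1)) : continuous (fun k => winding t k 0 j).
  rewrite /winding; case: (splitP j) => i ji.
    have -> : j = lshift 1 i by apply/val_inj.
    under eq_fun do rewrite row_mxEl; exact: coord_continuous.
  have -> : j = rshift d i by apply/val_inj.
  under eq_fun do rewrite row_mxEr mxE.
  apply: sum_continuous => s; exact: scaled_coord_continuous.
suff cWk (k : 'rV[R]_d) : winding t y @[y --> k] --> winding t k by exact: cWk.
apply/(@cvg_ballP _ _ _ _ (nbhs_filter k)) => e e0.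
have : \forall y \near k, forall j, ball (winding t k 0 j) e (winding t y 0 j).
  by apply: (@filter_forall _ _ _ _ (nbhs_filter k)) => j;
    apply/(@cvg_ballP _ _ _ _ (nbhs_filter k)) : e e0; exact: cW.
by apply: filterS => y wy; split => // i j; rewrite !ord1; exact: wy.
Qed.

Lemma winding_periodic d (t : 'rV[int]_d) m k : exists m',
  winding t (k + pshift m) = winding t k + pshift m'.
Proof.
(* Shifting [k] by 2 pi m changes <t, k> by 2 pi <t, m>, and <t, m> is an integer. *)
exists (row_mx m (const_mx (\sum_s t 0 s * m 0 s))).
rewrite /winding /pshift map_row_mx add_row_mx; congr row_mx.
apply/rowP => i; rewrite !mxE raddf_sum mulr_sumr -big_split/=.
by apply: eq_bigr => s _; rewrite !mxE intrM; ring.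
Qed.

(** If every |t_s| were at most [B], then |t| would be at most the square root of d B^2; this is the
    threshold [M]. *)
Lemma enorm_large d (B : R) : 0 <= B -> exists M : R,
  forall t : 'rV[int]_d, M < enorm R t -> exists s, B < `|(t 0 s)%:~R : R|.
Proof.
move=> B0; exists (Num.sqrt (\sum_(s < d) B ^+ 2)) => t tM.
apply: contrapT => /forallNP tB; move: tM; apply/negP; rewrite -leNgt.
rewrite ler_wsqrtr// ler_sum// => s _; rewrite -real_normK ?num_real//.
by rewrite lerXn2r ?nnegrE// leNgt; apply/negP/tB.
Qed.

Lemma winding_dense d (t : 'rV[int]_d) (s : 'I_d) (x : 'rV[R]_(d + 1)) (e : R) :
  0 < e -> pi < e * `|(t 0 s)%:~R| -> exists k m,
  ball x e (winding t k + pshift m).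
Proof.
move=> e0 te; pose k0 := lsubmx x.
pose ph (k : 'rV[R]_d) : R := \sum_i (t 0 i)%:~R * k 0 i.
have t0 : (t 0 s)%:~R != 0 :> R.
  by apply: contraTneq te => ->; rewrite normr0 mulr0 -leNgt pi_ge0.
(* [c] is the phase defect reduced modulo 2 pi. Moving coordinate s by c / t_s changes <t, k> by
   exactly c, at a cost of at most pi / |t_s| < e. *)
have [z] := angle_rep (x 0 (rshift d 0) - ph k0); set c := (X in _ < X <= _) => cpi.
pose k := k0 + (c / (t 0 s)%:~R) *: delta_mx 0 s.
have phk : ph k = ph k0 + c.
  rewrite /ph /k; under eq_bigr do rewrite mxE mulrDr.
  rewrite big_split/=; congr (_ + _); rewrite (bigD1 s)//= big1 => [|i /negPf i_s].
    by rewrite !mxE !eqxx addr0 mulr1 mulrC divfK.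
  by rewrite !mxE i_s andbF !mulr0.
(* The phase of [k] now exceeds the last coordinate of [x] by 2 pi z; the shift removes this excess,
   so that coordinate is reached exactly. *)
exists k, (row_mx 0 (const_mx (- z))); split => // i j; rewrite !ord1{i}.
rewrite -[x]hsubmxK /winding -/(ph k) phk /pshift map_row_mx add_row_mx.
case: (splitP j) => i ji.
  have -> : j = lshift 1 i by apply/val_inj.
  rewrite !row_mxEl (_ : (k + _) 0 i = k0 0 i + c / (t 0 s)%:~R * (i == s)%:R).
    rewrite /ball/= opprD addNKr normrN; have [_|_] := eqVneq i s; last first.
      by rewrite mulr0 normr0.
    rewrite mulr1 normrM normfV ltr_pdivrMr ?normr_gt0//.
    apply: le_lt_trans te; rewrite ler_norml; case/andP: cpi => /ltW -> ->.
    by [].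
  by rewrite !mxE/= mulr0 addr0.
have -> : j = rshift d i by apply/val_inj.
rewrite !row_mxEr !mxE !ord1 /ball/= /c mulrNz.
rewrite (_ : _ - _ = 0) ?normr0//; ring.
Qed.

(** Not a proper filter in general: for d = 0 the norm vanishes identically and the empty set
    belongs to it. *)
Global Instance at_infty_filter d : Filter (at_infty R d).
Proof.
apply: filter_from_filter; first by exists 0.
move=> M N _ _; exists (Num.max M N) => // t /=.
by rewrite gt_max => /andP[].
Qed.

(** Restricting [F] to a winding can only raise its minimum, so one bound is free. For the other, a
    winding with large [t] passes close to a minimiser [c], where [F] is close to [F c]. *)
Lemma min_on_winding_cvg d (F : 'rV[R]_(d + 1) -> R) :
  continuous F -> torus_periodic F ->
  min_on (torus R d) (F \o winding t) @[t --> at_infty R d]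
    --> min_on (torus R (d + 1)) F.
Proof.
move=> cF pF; have [c Tc cmin] := periodic_min cF pF.
rewrite (min_onE Tc)//; apply/cvgrPdist_lt => e e0.
have /cvgrPdist_lt/(_ e e0)/nbhs_ballP[r/= r0 rP] := cF c.
(* Beyond this threshold some |t_s| exceeds pi / r, which is what [winding_dense] requires to come
   within r of [c]. *)
have [M MP] := @enorm_large d (pi / r) (divr_ge0 (pi_ge0 _) (ltW r0)).
exists M => // t /= /MP[s]; rewrite ltr_pdivrMr// mulrC => ts.
have [k [m /rP]] := winding_dense c r0 ts.
have [||b Tb bmin] := @periodic_min d (F \o winding t).
- by move=> x; apply: continuous_comp; [exact: winding_continuous|exact: cF].
- by move=> n x /=; have [n' ->] := winding_periodic t n x; rewrite pF.
rewrite (min_onE Tb (fun x _ => bmin x)) pF/= !(distrC (F c)) => ck.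
rewrite ger0_norm ?subr_ge0//; apply: le_lt_trans (ltr_normlW ck).
by rewrite lerB//; exact: bmin.
Qed.

Lemma max_on_winding_cvg d (F : 'rV[R]_(d + 1) -> R) :
  continuous F -> torus_periodic F ->
  max_on (torus R d) (F \o winding t) @[t --> at_infty R d]
    --> max_on (torus R (d + 1)) F.
Proof.
move=> cF pF; rewrite max_on_torus//.
under eq_fun => t.
  rewrite max_on_torus; last first.
  - by move=> n x /=; have [n' ->] := winding_periodic t n x; rewrite pF.
  - by move=> x; apply: continuous_comp; [exact: winding_continuous|exact: cF].
  over.
apply: cvgN; apply: (@min_on_winding_cvg d (- F)).
- by move=> x; exact: cvgN (cF x).
- by move=> m x; rewrite !fctE pF.
Qed.

End Torus.

(** * Fiber matrices *)

Section Lattice.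
Variables (R : realType) (d : nat) (G : latgraph R d).

Lemma lvecD m n : lvec G (m + n) = lvec G m + lvec G n.
Proof. by rewrite /lvec map_mxD mulmxDl. Qed.

Lemma lvec0 : lvec G 0 = 0.
Proof. by rewrite /lvec map_mx0 mul0mx. Qed.

Lemma lvecN m : lvec G (- m) = - lvec G m.
Proof. by rewrite /lvec map_mxN mulNmx. Qed.

Lemma cellE x : cell G x <-> intpart G x = 0.
Proof.
split=> [cx|/rowP ix s].
  by apply/rowP => s; rewrite [LHS]mxE [RHS]mxE; apply: floor_def; rewrite add0r; exact: cx.
by have := floor_itv (coords G x 0 s); have := ix s; rewrite [LHS]mxE [RHS]mxE => ->; rewrite add0r.
Qed.

Lemma cellpart_id x : cell G x -> cellpart G x = x.
Proof. by move=> /cellE xc; rewrite /cellpart xc lvec0 subr0. Qed.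

Hypothesis Gu : Defs.basis G \in unitmx.

Lemma coords_lvecD x m :
  coords G (x + lvec G m) = coords G x + map_mx (fun z : int => z%:~R) m.
Proof. by rewrite /coords mulmxDl /lvec mulmxK. Qed.

Lemma intpartD x m : intpart G (x + lvec G m) = intpart G x + m.
Proof.
rewrite /intpart coords_lvecD; apply/rowP => s.
rewrite [LHS]mxE [in LHS]mxE [X in Num.floor (_ + X)]mxE [RHS]mxE [X in _ = X + _]mxE.
by rewrite floorDrz ?intr_int// intrKfloor.
Qed.

Lemma cellpartD x m : cellpart G (x + lvec G m) = cellpart G x.
Proof. by rewrite /cellpart intpartD lvecD opprD addrACA subrr addr0. Qed.

(** Used to see that the orbit of the added edge contributes exactly one edge per orientation to the
    fundamental graph. *)
Lemma cell_shift x m : cell G x -> cell G (x + lvec G m) <-> m = 0.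
Proof. by move=> /cellE xc; rewrite cellE intpartD xc add0r. Qed.

Lemma cellpart_cell x : cell G (cellpart G x).
Proof. by apply/cellE; rewrite /cellpart -lvecN intpartD subrr. Qed.

End Lattice.

(** * Entries of the fiber matrices *)

Section Hop.
Variable R : realType.

(* The contribution to the (p, q) entry of the fiber matrix of an oriented edge
   of the fundamental graph from u to u' with phase phi. *)
Definition hop (n : nat) (u u' : 'rV[R]_n) (phi : R) (p q : 'rV[R]_n) : R[i] :=
  (u == p)%:R * ((p == q)%:R - expi phi * (u' == q)%:R).

(** The condition on the source is absorbed into the indicator in [hop]. All entries are then sums
    over one and the same edge set, which can be split into old and added edges. *)
Lemma fiber_mxE n (H : latgraph R n) Q k i j :
  fiber_mx H Q k i j =
  \sum_(e \in @fund_edge R n H)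
    hop (src e) (cellpart H (tgt e)) (index_phase e k) (vtx i) (vtx j)
  + (Q (vtx i))%:C%C * (vtx i == vtx j)%:R.
Proof.
rewrite mxE /fiber_schrodinger /fiber_laplacian; congr (_ + _); last by case: eqP.
rewrite -[X in \sum_(_ \in X) _]/(@fund_edge R n H `&` [set e | src e = vtx i]).
rewrite fsbig_mkcondr; apply: eq_fsbigr => e _; rewrite /hop.
case: (eqVneq (src e) (vtx i)) => [se|/eqP se].
  by rewrite mem_set//= mul1r; do 2 case: ifP.
by rewrite memNset//= mul0r.
Qed.

Lemma expi_conj (x : R) : (expi x)^*%C = expi (- x).
Proof. by rewrite /expi cosN sinN. Qed.

Lemma expi_2pi (x : R) (z : int) : expi (x + pi *+ 2 * z%:~R) = expi x.
Proof.
have h (y : R) (n : nat) : expi (y + pi *+ 2 * n%:R) = expi y.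
  rewrite mulr_natr /expi; congr (_ +i* _)%C.
    exact: periodicn (@cosD2pi R) n y.
  exact: periodicn (@sinD2pi R) n y.
case: z => n; first exact: h.
by rewrite -[RHS](h _ n.+1) -[LHS](h _ n.+1) NegzE mulrNz -pmulrn mulrN addrNK h.
Qed.

End Hop.

Section Vertices.
Variables (R : realType) (d n : nat) (G : latgraph R d) (H : latgraph R n).
Hypothesis Gfin : finite_set (fund_vert G).

Lemma vtx_fund (i : 'I_(nu G)) : fund_vert G (vtx i).
Proof.
by apply/set_mem; rewrite -in_fset_set// mem_nth.
Qed.

Lemma vtx_inj : injective (@vtx R d G).
Proof.
move=> i j /eqP; rewrite nth_uniq ?fset_uniq ?ltn_ord// => /eqP ij.
exact: val_inj.
Qed.

(** The fundamental vertices are enumerated in an arbitrary order that [f] need not respect, so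
    matching them costs a permutation [s] of the indices, later absorbed by
    [char_poly_conj_reindex]. *)
Lemma vtx_bij (f : 'rV[R]_d -> 'rV[R]_n) : injective f ->
  fund_vert H = f @` fund_vert G ->
  exists2 s : 'I_(nu G) -> 'I_(nu H), bijective s & forall i, vtx (s i) = f (vtx i).
Proof.
move=> fI HG.
have Hfin : finite_set (fund_vert H) by rewrite HG; exact: finite_image.
have mH (i : 'I_(nu G)) : f (vtx i) \in enum_fset (fset_set (fund_vert H)).
  by rewrite in_fset_set// HG; apply/mem_set; exists (vtx i); first exact: vtx_fund.
have idx (i : 'I_(nu G)) : (index (f (vtx i)) (enum_fset (fset_set (fund_vert H))) < nu H)%N.
  by rewrite index_mem.
exists (fun i => Ordinal (idx i)) => [|i]; last exact: nth_index.
apply: inj_card_bij => [i j /(congr1 val)/= ij|].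
  apply/vtx_inj/fI; rewrite -(nth_index 0 (mH i)) ij; exact: nth_index.
by rewrite !card_ord /nu HG fset_set_image// card_imfset.
Qed.

End Vertices.

(** * Continuity of complex-valued functions *)

Section ComplexContinuity.
Variables (R : realType) (T : topologicalType).
Implicit Types f g : T -> R[i].

Definition ccont f :=
  continuous (fun x => complex.Re (f x)) /\ continuous (fun x => complex.Im (f x)).

Lemma ccont_cst c : ccont (fun=> c).
Proof. by split; exact: cst_continuous. Qed.

Lemma ccontD f g : ccont f -> ccont g -> ccont (fun x => f x + g x).
Proof.
move=> [rf jf] [rg jg].
have ReD x : complex.Re (f x + g x) = complex.Re (f x) + complex.Re (g x).
  by case: (f x) (g x) => [? ?] [].
have ImD x : complex.Im (f x + g x) = complex.Im (f x) + complex.Im (g x).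
  by case: (f x) (g x) => [? ?] [].
split; [under eq_fun do rewrite ReD|under eq_fun do rewrite ImD].
  by move=> x; apply: continuousD; [exact: rf|exact: rg].
by move=> x; apply: continuousD; [exact: jf|exact: jg].
Qed.

Lemma ccontM f g : ccont f -> ccont g -> ccont (fun x => f x * g x).
Proof.
move=> [rf jf] [rg jg].
have ReM x : complex.Re (f x * g x) =
    complex.Re (f x) * complex.Re (g x) - complex.Im (f x) * complex.Im (g x).
  by case: (f x) (g x) => [? ?] [].
have ImM x : complex.Im (f x * g x) =
    complex.Re (f x) * complex.Im (g x) + complex.Im (f x) * complex.Re (g x).
  by case: (f x) (g x) => [? ?] [].
split; [under eq_fun do rewrite ReM|under eq_fun do rewrite ImM] => x.
  apply: (@cvgB _ _ _ _ (nbhs_filter x)); apply: (@cvgM _ _ _ (nbhs_filter x)).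
  - exact: rf.
  - exact: rg.
  - exact: jf.
  - exact: jg.
apply: (@cvgD _ _ _ _ (nbhs_filter x)); apply: (@cvgM _ _ _ (nbhs_filter x)).
- exact: rf.
- exact: jg.
- exact: jf.
- exact: rg.
Qed.

Lemma ccont_sum (I : Type) (r : seq I) (F : I -> T -> R[i]) :
  (forall i, ccont (F i)) -> ccont (fun x => \sum_(i <- r) F i x).
Proof.
move=> cF; elim: r => [|i r IHr].
  under eq_fun do rewrite big_nil; exact: ccont_cst.
by under eq_fun do rewrite big_cons; exact: ccontD.
Qed.

Lemma ccont_expi (phi : T -> R) : continuous phi -> ccont (fun x => expi (phi x)).
Proof.
move=> cphi; split => x /=; apply: continuous_comp (cphi x) _.
  exact: continuous_cos.
exact: continuous_sin.
Qed.

Lemma ccont_near f x (e : R) : ccont f -> 0 < e ->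
  \forall y \near x, `|f x - f y| <= e%:C%C.
Proof.
move=> [/(_ x) rf /(_ x) jf] e0.
(* The modulus is at most the sum of the absolute values of the real and imaginary parts; each gets
   half of [e]. *)
have e20 : 0 < e / 2 by rewrite divr_gt0.
have hr := @cvgr_dist_le _ _ _ _ (nbhs_filter x) _ _ rf _ e20.
have hi := @cvgr_dist_le _ _ _ _ (nbhs_filter x) _ _ jf _ e20.
apply: filterS2 hr hi => y.
case: (f x) (f y) => [a b] [a' b'] /= ha hb.
rewrite [X in `|X|](_ : _ = (a - a')%:C + 'i * (b - b')%:C)%C; last first.
  by rewrite [LHS]complexE.
rewrite [e]splitr [leRHS]rmorphD; apply: le_trans (ler_normD _ _) _; apply: lerD.
  by rewrite normc_def/= expr0n addr0 sqrtr_sqr lecR.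
rewrite normrM [X in X * _](_ : _ = 1) ?mul1r.
  by rewrite normc_def/= expr0n addr0 sqrtr_sqr lecR.
by rewrite normc_def/= expr0n add0r expr1n sqrtr1.
Qed.

End ComplexContinuity.

(** * The model matrix on the (d+1)-torus *)

Section Model.
Variables (R : realType) (d : nat) (G : latgraph R d).
Hypothesis hG : periodic_graph G.
Variables (v1 v2 : 'rV[R]_d) (Q : 'rV[R]_d -> R).

(* The last coordinate of x is the phase carried by the added edge. *)
Definition model_mx (x : 'rV[R]_(d + 1)) : 'M[R[i]]_(nu G) :=
  \matrix_(i, j)
   (\sum_(e \in @fund_edge R d G)
      hop (src e) (cellpart G (tgt e)) (index_phase e (lsubmx x)) (vtx i) (vtx j)
    + hop v1 v2 (x 0 (rshift d 0)) (vtx i) (vtx j)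
    + hop v2 v1 (- x 0 (rshift d 0)) (vtx i) (vtx j)
    + (Q (vtx i))%:C%C * (vtx i == vtx j)%:R).

Let Gu : Defs.basis G \in unitmx := pg_basis hG.
Let fin := pg_fund_edge hG.

Lemma tgt_shift m (e : edge G) : tgt (eshift m e) = tgt e + lvec G m.
Proof.
by rewrite -!(pg_src_rev hG) -(pg_shift_rev hG) (pg_src_shift hG).
Qed.

(** Reversal of oriented edges in the quotient A_*: [erev e] starts at [tgt e], so it is translated
    back to the representative of its orbit that starts in the cell. *)
Definition fund_rev (e : edge G) : edge G :=
  eshift (- intpart G (tgt e)) (erev e).

Lemma src_fund_rev e : src (fund_rev e) = cellpart G (tgt e).
Proof. by rewrite (pg_src_shift hG) (pg_src_rev hG) lvecN. Qed.

Lemma tgt_fund_rev e : tgt (fund_rev e) = src e - lvec G (intpart G (tgt e)).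
Proof.
by rewrite tgt_shift -(pg_src_rev hG) (pg_revK hG) lvecN.
Qed.

Lemma fund_rev_fund e : fund_edge (fund_rev e).
Proof. by rewrite /fund_edge/= src_fund_rev; exact: cellpart_cell. Qed.

Lemma cellpart_tgt_fund_rev e : fund_edge e -> cellpart G (tgt (fund_rev e)) = src e.
Proof.
by move=> fe; rewrite tgt_fund_rev -lvecN cellpartD// cellpart_id.
Qed.

Lemma index_fund_rev e : fund_edge e -> edge_index (fund_rev e) = - edge_index e.
Proof.
move=> fe; rewrite /edge_index src_fund_rev tgt_fund_rev -!lvecN.
rewrite intpartD// /cellpart -lvecN intpartD// subrr subr0.
by rewrite opprB.
Qed.

Lemma fund_revK e : fund_edge e -> fund_rev (fund_rev e) = e.
Proof.
move=> fe; rewrite {1}/fund_rev tgt_fund_rev -lvecN intpartD//.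
have /cellE -> : cell G (src e) by [].
rewrite add0r opprK /fund_rev -(pg_shift_rev hG) (pg_revK hG) -(pg_shiftD hG).
by rewrite subrr (pg_shift0 hG).
Qed.

Lemma fund_rev_bij : set_bij (@fund_edge R d G) (@fund_edge R d G) fund_rev.
Proof.
split=> [e _|e e' /set_mem fe /set_mem fe' ee'|e fe].
- exact: fund_rev_fund.
- by rewrite -(fund_revK fe) ee' fund_revK.
- by exists (fund_rev e); [exact: fund_rev_fund|exact: fund_revK].
Qed.

Lemma index_phase_fund_rev e k : fund_edge e ->
  index_phase (fund_rev e) k = - index_phase e k.
Proof.
move=> fe; rewrite /index_phase (index_fund_rev fe) -sumrN.
by apply: eq_bigr => s _; rewrite mxE mulrNz mulNr.
Qed.

Lemma hop_conj n (u u' p q : 'rV[R]_n) phi :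
  (hop u u' phi q p)^*%C =
  (u == q)%:R * (p == q)%:R - (u == q)%:R * (u' == p)%:R * expi (- phi).
Proof.
rewrite -expi_conj /hop; move: (expi phi) => z.
rewrite rmorphM rmorphB rmorphM !rmorph_nat mulrBr (eq_sym q p).
by rewrite [X in _ - _ * X]mulrC mulrA.
Qed.

Lemma hopE n (u u' p q : 'rV[R]_n) phi :
  hop u u' phi p q =
  (u == p)%:R * (p == q)%:R - (u' == q)%:R * (u == p)%:R * expi phi.
Proof. by rewrite /hop; ring. Qed.

Lemma hop_diag n (u p q : 'rV[R]_n) :
  (u == q)%:R * (p == q)%:R = (u == p)%:R * (p == q)%:R :> R[i].
Proof. by case: (eqVneq p q) => [->//|]; rewrite !mulr0. Qed.

(** Conjugating the hopping of an edge and swapping indices gives the hopping of its inverse, so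
    reindexing by [fund_rev] leaves the sum invariant. The two orientations of the added edge are
    swapped in the same way, and the degree and potential terms are real and diagonal. *)
Lemma model_hermitian x : model_mx x \is hermsymmx.
Proof.
apply/is_hermitianmxP; rewrite expr0 scale1r; apply/matrixP => i j.
rewrite [RHS]mxE [in RHS]mxE -[RHS]/((model_mx x j i)^*%C) [LHS]mxE [in RHS]mxE.
set p := vtx i; set q := vtx j; set th := x _ _.
rewrite 3!rmorphD/= !hop_conj opprK !hopE !(hop_diag _ p q).
congr (_ + _); last first.
  rewrite rmorphM rmorph_nat [X in _ = X * _]conjc_real (eq_sym q p).
  by case: (eqVneq p q) => [->//|]; rewrite !mulr0.
rewrite -!addrA; congr (_ + _); last by ring.
rewrite !fsbig_finite// rmorph_sum/= -!fsbig_finite//.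
under [LHS]eq_fsbigr do rewrite hopE.
under [RHS]eq_fsbigr do rewrite hop_conj hop_diag.
rewrite !fsbig_finite// !sumrB -!fsbig_finite//; congr (_ - _).
rewrite [RHS](reindex_fsbig _ _ _ _ fund_rev_bij).
apply: eq_fsbigr => e /set_mem fe.
by rewrite src_fund_rev (cellpart_tgt_fund_rev fe) (index_phase_fund_rev _ fe) opprK.
Qed.

Lemma model_periodic : torus_periodic model_mx.
Proof.
move=> m x; apply/matrixP => i j; rewrite !mxE; congr (_ + _).
have hopS u u' phi p q (z : int) :
    hop u u' (phi + pi *+ 2 * z%:~R) p q = hop u u' phi p q :> R[i].
  by rewrite /hop expi_2pi.
rewrite opprD -mulrN -mulrNz !hopS; congr (_ + _ + _).
apply: eq_fsbigr => e _.
suff [z ->] : exists z : int, index_phase e (lsubmx (x + pshift R m)) =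
   index_phase e (lsubmx x) + pi *+ 2 * z%:~R by rewrite hopS.
exists (\sum_s edge_index e 0 s * m 0 (lshift 1 s)).
rewrite /index_phase raddf_sum mulr_sumr -big_split/=.
by apply: eq_bigr => s _; rewrite !mxE intrM; ring.
Qed.

Lemma model_ccont i j : ccont (fun x => model_mx x i j).
Proof.
have coordC (k : 'I_(d + 1)) : continuous (fun x : 'rV[R]_(d + 1) => x 0 k).
  exact: coord_continuous.
have hopC u u' (phi : 'rV[R]_(d + 1) -> R) p q : continuous phi ->
    ccont (fun x => hop u u' (phi x) p q : R[i]).
  move=> cphi; apply: ccontM; first exact: ccont_cst.
  under eq_fun do rewrite -mulNr -mulN1r.
  apply: ccontD; first exact: ccont_cst.
  apply: ccontM; last exact: ccont_cst.
  by apply: ccontM; [exact: ccont_cst|exact: ccont_expi].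
under eq_fun do rewrite mxE; apply: ccontD; last exact: ccont_cst.
apply: ccontD; last first.
  by apply: hopC => x; apply: continuousN; exact: coordC.
apply: ccontD; last exact: hopC.
under eq_fun do rewrite fsbig_finite//; apply: ccont_sum => e; apply: hopC.
rewrite /index_phase; apply: sum_continuous => s.
by under eq_fun do rewrite [lsubmx _ _ _]mxE; exact: scaled_coord_continuous.
Qed.

Definition model_band j x := nth 0 (eigenvalues (model_mx x)) j.-1.

Lemma model_band_periodic j : torus_periodic (model_band j).
Proof. by move=> m x; rewrite /model_band model_periodic. Qed.

Lemma model_band_continuous j : continuous (model_band j).
Proof.
suff cb (x : 'rV[R]_(d + 1)) : model_band j y @[y --> x] --> model_band j x by exact: cb.
apply/(@cvgrPdist_le _ _ _ _ (nbhs_filter x)) => e e0.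
(* [eigenvalue_dist] loses a factor [nu G]; the successor keeps the denominator positive. *)
pose e' := e / (nu G).+1%:R.
have e'0 : 0 < e' by rewrite divr_gt0.
have : \forall y \near x, forall p : 'I_(nu G) * 'I_(nu G),
    `|model_mx x p.1 p.2 - model_mx y p.1 p.2| <= e'%:C%C.
  apply: (@filter_forall _ _ _ _ (nbhs_filter x)) => p.
  exact: ccont_near (model_ccont _ _) e'0.
apply: (@filterS _ _ (nbhs_filter x)) => y xy.
apply: le_trans (eigenvalue_dist _ (model_hermitian x) (model_hermitian y) (ltW e'0) _) _.
  by move=> i k; exact: (xy (i, k)).
by rewrite /e' mulrCA ler_piMr// ?(ltW e0)// ler_pdivrMr// mul1r ler_nat.
Qed.

(** Common to the perturbed and the limit graph: [H] has the fundamental graph of [G], transported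
    by [f] and [iota], plus one edge whose two orientations are [o1] and [o2]. These stay distinct
    even when v1 = v2, so a loop contributes twice. Phases match when [k] for [H] corresponds to [x]
    in the model. *)
Lemma band_reduction n (H : latgraph R n) (f : 'rV[R]_d -> 'rV[R]_n)
    (iota : edge G -> edge H) (o1 o2 : edge H) (Q' : 'rV[R]_n -> R) j k x :
  injective f -> fund_vert H = f @` fund_vert G ->
  fund_vert G v1 -> fund_vert G v2 ->
  injective iota -> (forall e, iota e <> o1) -> (forall e, iota e <> o2) -> o1 <> o2 ->
  @fund_edge R n H = (iota @` @fund_edge R d G) `|` [set o1] `|` [set o2] ->
  (forall e, src (iota e) = f (src e)) ->
  (forall e, cellpart H (tgt (iota e)) = f (cellpart G (tgt e))) ->
  (forall e, index_phase (iota e) k = index_phase e (lsubmx x)) ->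
  src o1 = f v1 -> cellpart H (tgt o1) = f v2 ->
  index_phase o1 k = x 0 (rshift d 0) ->
  src o2 = f v2 -> cellpart H (tgt o2) = f v1 ->
  index_phase o2 k = - x 0 (rshift d 0) ->
  (forall v, fund_vert G v -> Q' (f v) = Q v) ->
  band H Q' j k = model_band j x.
Proof.
move=> fI HG v1G v2G iI io1 io2 o12 HE sI tI pI s1 t1 p1 s2 t2 p2 QQ.
have [s sb sE] := vtx_bij (pg_fund_vert hG) fI HG.
suff E : eigenvalues (model_mx x) = eigenvalues (fiber_mx H Q' k).
  by rewrite /model_band E.
apply/eq_eigenvalues/(char_poly_conj_reindex sb) => i l.
rewrite fiber_mxE mxE !sE QQ; last exact: vtx_fund (pg_fund_vert hG) i.
have hopf u u' phi p q : hop (f u) (f u') phi (f p) (f q) = hop u u' phi p q.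
  by rewrite /hop !(inj_eq fI).
rewrite (inj_eq fI); congr (_ + _).
have finI : finite_set (iota @` @fund_edge R d G) by exact: finite_image.
rewrite HE fsbigU0//; last 2 first.
- by rewrite finite_setU.
- by move=> e [[[e' _ <-]|->]] /= /esym; [move/esym/io2|move/esym/o12].
rewrite fsbigU0//; last by move=> e [[e' _ <-]] /= /io1.
rewrite !fsbig_set1 s1 t1 p1 s2 t2 p2 !hopf; congr (_ + _ + _).
rewrite fsbig_image; last by move=> e e' _ _ /iI.
by apply: eq_fsbigr => e _; rewrite sI tI pI hopf.
Qed.

End Model.

(** * Perturbed and limit graphs *)

Section Perturbed.
Variables (R : realType) (d : nat) (G : latgraph R d).
Hypothesis hG : periodic_graph G.
Variables (v1 v2 : 'rV[R]_d) (Q : 'rV[R]_d -> R).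
Hypotheses (hv1 : fund_vert G v1) (hv2 : fund_vert G v2).

Let Gu : Defs.basis G \in unitmx := pg_basis hG.

Lemma band_perturbed t j k :
  band (perturbed G v1 v2 t) Q j k = model_band G v1 v2 Q j (winding t k).
Proof.
have [_ c1] := hv1; have [_ c2] := hv2.
pose H := perturbed G v1 v2 t.
(* Representatives starting in the cell: e_o starts at v1, while its reverse starts at v2 + t and
   must be translated by -t. *)
pose o1 : edge H := inr (0, false); pose o2 : edge H := inr (- t, true).
have io (m : 'rV[int]_d * bool) (e : edge G) : (inl e : edge H) <> inr m by [].
have s1 : src o1 = v1 by rewrite /src/= /pert_end lvec0 addr0.
have t1 : tgt o1 = v2 + lvec G t by rewrite /tgt/= /pert_end lvec0 addr0.
have s2 : src o2 = v2 by rewrite /src/= /pert_end -addrA -lvecD subrr lvec0 addr0.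
have t2 : tgt o2 = v1 - lvec G t by rewrite /tgt/= /pert_end lvecN.
have HE : @fund_edge R d H =
    [set (inl e : edge H) | e in @fund_edge R d G] `|` [set o1] `|` [set o2].
  apply/seteqP; split => [[e|[m []]]|e].
  - by move=> fe; left; left; exists e.
  - rewrite /fund_edge/= /pert_end -addrA -lvecD => /(cell_shift Gu _ c2) tm.
    by right; congr (inr (_, _)); apply/eqP; rewrite -addr_eq0 addrC tm.
  - rewrite /fund_edge/= /pert_end => /(cell_shift Gu _ c1) ->.
    by left; right.
  case=> [[[e' fe' <-]|->]|->]; first exact: fe'.
    by rewrite /fund_edge [X in X _]/mkset s1.
  by rewrite /fund_edge [X in X _]/mkset s2.
have x1 : winding t k 0 (rshift d 0) = \sum_s (t 0 s)%:~R * k 0 s.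
  by rewrite row_mxEr mxE.
have [i1 i2] : intpart G v1 = 0 /\ intpart G v2 = 0 by split; apply/cellE.
have p1 : index_phase o1 k = winding t k 0 (rshift d 0).
  rewrite x1 /index_phase /edge_index s1 t1.
  by rewrite -[intpart H]/(intpart G) intpartD// i1 i2 subr0 add0r.
have p2 : index_phase o2 k = - winding t k 0 (rshift d 0).
  rewrite x1 /index_phase /edge_index s2 t2 -lvecN.
  rewrite -[intpart H]/(intpart G) intpartD// i1 i2 subr0 add0r -sumrN.
  by apply: eq_bigr => s _; rewrite mxE mulrNz mulNr.
refine (@band_reduction _ _ _ hG _ _ _ _ H id (fun e => inl e : edge H) o1 o2 Q j k _
  (fun _ _ h => h) _ hv1 hv2 _ (io _) (io _) _ HE _ _ _ s1 _ p1 s2 _ p2 _).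
- by rewrite image_id.
- by move=> e e' [].
- by case.
- by [].
- by [].
- by move=> e; rewrite row_mxKl.
- by rewrite t1 -[cellpart H]/(cellpart G) cellpartD// cellpart_id.
- by rewrite t2 -lvecN -[cellpart H]/(cellpart G) cellpartD// cellpart_id.
- by [].
Qed.

End Perturbed.

(** * Fundamental graph and bands of the limit graph *)

Section Limit.
Variables (R : realType) (d : nat) (G : latgraph R d).
Hypothesis hG : periodic_graph G.
Variables (v1 v2 : 'rV[R]_d) (Q : 'rV[R]_d -> R).
Hypotheses (hv1 : fund_vert G v1) (hv2 : fund_vert G v2).
Variables (a : 'rV[R]_(d + 1)).
Hypothesis ha : limit_basis G a \in unitmx.

Let Gu : Defs.basis G \in unitmx := pg_basis hG.
Let H := limit_graph G v1 v2 a.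

(** Although [a] may have components along R^d, the layer number is the last coordinate in the limit
    basis. Integer parts and cells of the limit graph are computed from this. *)
Lemma layer_coords (x : 'rV[R]_d) (n : int) :
  layer a x n = row_mx (coords G x) (const_mx n%:~R) *m limit_basis G a.
Proof.
rewrite /limit_basis mul_row_col mul_mx_row mulmx0 /coords mulmxKV//.
congr (_ + _); apply/rowP => i; rewrite !mxE big_ord1 !mxE.
by congr (_ * a _ _); rewrite !ord1.
Qed.

Lemma coords_layer x n : coords H (layer a x n) = row_mx (coords G x) (const_mx n%:~R).
Proof. by rewrite layer_coords /coords mulmxK. Qed.

Lemma intpart_layer x n : intpart H (layer a x n) = row_mx (intpart G x) (const_mx n).
Proof.
rewrite /intpart coords_layer map_row_mx; congr row_mx.
by apply/rowP => i; rewrite !mxE intrKfloor.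
Qed.

Lemma lvec_layer m : lvec H m = layer a (lvec G (lsubmx m)) (rsubmx m 0 0).
Proof.
rewrite layer_coords /lvec; congr (_ *m _).
rewrite -[m in LHS]hsubmxK map_row_mx; congr row_mx.
  by rewrite /coords mulmxK.
by apply/rowP => i; rewrite !mxE ord1.
Qed.

Lemma layerD x y m n : layer a x m + layer a y n = layer a (x + y) (m + n).
Proof.
by rewrite /layer addrACA -scalerDl intrD /emb add_row_mx addr0.
Qed.

Lemma layer0 x : layer a x 0 = emb x.
Proof. by rewrite /layer scale0r addr0. Qed.

Lemma emb_inj : injective (@emb R d).
Proof. by move=> x y /eq_row_mx[]. Qed.

Lemma cellpart_layer x n : cellpart H (layer a x n) = emb (cellpart G x).
Proof.
rewrite /cellpart -lvecN intpart_layer opp_row_mx lvec_layer row_mxKl row_mxKr.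
by rewrite layerD mxE mxE subrr layer0 lvecN.
Qed.

Lemma cell_layer x n : cell H (layer a x n) <-> cell G x /\ n = 0.
Proof.
rewrite !cellE intpart_layer -row_mx0; split=> [/eq_row_mx[-> /rowP/(_ 0)]|[-> ->]].
  by rewrite !mxE.
by congr row_mx; apply/rowP => i; rewrite !mxE.
Qed.

(** The boolean is read as an integer because the reversed edge starts one layer higher, at v2 +
    a. *)
Lemma limit_endE m b : limit_end G v1 v2 a m b =
  layer a ((if b then v2 else v1) + lvec G (lsubmx m)) (b%:Z + rsubmx m 0 0).
Proof.
rewrite /limit_end -[_ *m _]/(lvec H m) lvec_layer -layerD; congr (_ + _).
by case: b; rewrite /layer ?scale1r ?scale0r ?addr0.
Qed.

Lemma fund_vert_limit : fund_vert H = @emb R d @` fund_vert G.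
Proof.
apply/seteqP; split => [y [[x [n [vx ->]]] /cell_layer[cx ->]]|_ [x [vx cx] <-]].
  by exists x; rewrite ?layer0.
rewrite -layer0; split; first by exists x, 0.
exact/cell_layer.
Qed.

(** Edges inside a copy of [G] have p = q and ignore the last coordinate of [k]; the added edges
    have q - p = 1 or -1 and carry it as their phase. *)
Lemma limit_index_phaseE (e : edge H) x y p q (k : 'rV[R]_(d + 1)) :
  src e = layer a x p -> tgt e = layer a y q ->
  index_phase e k = \sum_s (intpart G y 0 s - intpart G x 0 s)%:~R * lsubmx k 0 s
    + (q - p)%:~R * k 0 (rshift d 0).
Proof.
move=> se te; rewrite /index_phase big_split_ord/= big_ord1; congr (_ + _).
  apply: eq_bigr => s _; rewrite /edge_index se te !intpart_layer.
  rewrite opp_row_mx add_row_mx row_mxEl !mxE; congr (_%:~R * _).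
by rewrite /edge_index se te !intpart_layer opp_row_mx add_row_mx row_mxEr !mxE.
Qed.

Lemma band_limit (Qt : 'rV[R]_(d + 1) -> R) j k :
  (forall v, fund_vert G v -> Qt (emb v) = Q v) ->
  band H Qt j k = model_band G v1 v2 Q j k.
Proof.
move=> QQ; have [_ c1] := hv1; have [_ c2] := hv2.
pose o1 : edge H := inr (0, false).
(* The reverse of e_o starts at v2 + a; translating by -a brings it to v2 in layer 0. *)
pose o2 : edge H := inr (row_mx 0 (const_mx (-1)), true).
pose iota (e : edge G) : edge H := inl (e, 0).
have io (m : 'rV[int]_(d + 1) * bool) (e : edge G) : iota e <> inr m by [].
have s1 : src o1 = layer a v1 0.
  by rewrite [LHS]limit_endE linear0 lvec0 !addr0 linear0 mxE.
have t1 : tgt o1 = layer a v2 1.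
  by rewrite [LHS]limit_endE linear0 lvec0 !addr0 linear0 mxE.
have s2 : src o2 = layer a v2 0.
  by rewrite [LHS]limit_endE row_mxKl row_mxKr lvec0 !addr0 mxE.
have t2 : tgt o2 = layer a v1 (-1).
  by rewrite [LHS]limit_endE row_mxKl row_mxKr lvec0 !addr0 mxE.
have HE : @fund_edge R (d + 1) H =
    [set iota e | e in @fund_edge R d G] `|` [set o1] `|` [set o2].
  apply/seteqP; split => [[[e n]|[m b]]|e].
  - by move=> /cell_layer[fe ->]; left; left; exists e.
  - rewrite /fund_edge [X in X _]/mkset [src _]limit_endE => /cell_layer[].
    rewrite -[m]hsubmxK row_mxKl row_mxKr; case: b => /cell_shift mE m1.
      right; congr (inr (row_mx _ _, _)); first exact: mE.
      apply/rowP => i; rewrite ord1 [RHS]mxE; apply/eqP.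
      by rewrite -addr_eq0 addrC m1.
    left; right; rewrite /o1 -row_mx0; congr (inr (row_mx _ _, _)); first exact: mE.
    by apply/rowP => i; rewrite ord1 [RHS]mxE -m1 add0r.
  case=> [[[e' fe' <-]|->]|->].
  - exact/cell_layer.
  - by rewrite /fund_edge [X in X _]/mkset s1; exact/cell_layer.
  - by rewrite /fund_edge [X in X _]/mkset s2; exact/cell_layer.
have [i1 i2] : intpart G v1 = 0 /\ intpart G v2 = 0 by split; apply/cellE.
have sum0 u w : intpart G u = 0 -> intpart G w = 0 ->
    \sum_s (intpart G u 0 s - intpart G w 0 s)%:~R * lsubmx k 0 s = 0 :> R.
  by move=> -> ->; rewrite big1// => s _; rewrite subrr mul0r.
have p1 : index_phase o1 k = k 0 (rshift d 0).
  by rewrite (limit_index_phaseE _ s1 t1) sum0// add0r subr0 mul1r.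
have p2 : index_phase o2 k = - k 0 (rshift d 0).
  by rewrite (limit_index_phaseE _ s2 t2) sum0// add0r subr0 mulN1r.
refine (@band_reduction _ _ _ hG _ _ _ _ H (@emb R d) iota o1 o2 Qt j k _
  emb_inj fund_vert_limit hv1 hv2 _ (io _) (io _) _ HE _ _ _ _ _ p1 _ _ p2 QQ).
- by move=> e e' [].
- by case.
- by move=> e; rewrite -layer0.
- by move=> e; rewrite -(cellpart_layer _ 0).
- move=> e; rewrite (@limit_index_phaseE _ (src e) (tgt e) 0 0)//.
  rewrite subrr mul0r addr0; apply: eq_bigr => s _.
  by rewrite /edge_index [in RHS]mxE [X in _ = (_ + X)%:~R * _]mxE.
- by rewrite s1 layer0.
- by rewrite t1 cellpart_layer cellpart_id.
- by rewrite s2 layer0.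
- by rewrite t2 cellpart_layer cellpart_id.
Qed.

End Limit.

Theorem theorem2p2 (R : realType) (d : nat) (G : latgraph R d)
  (hG : periodic_graph G)
  (v1 v2 : 'rV[R]_d) (hv1 : fund_vert G v1) (hv2 : fund_vert G v2)
  (Q : 'rV[R]_d -> R) (hQ : periodic_potential G Q)
  (a : 'rV[R]_(d + 1)) (ha : limit_basis G a \in unitmx)
  (Qt : 'rV[R]_(d + 1) -> R)
  (hQt : periodic_potential (limit_graph G v1 v2 a) Qt)
  (hQtQ : forall v, fund_vert G v -> Qt (emb v) = Q v)
  (j : nat) (hj : (1 <= j <= nu G)%N) :
  band_min (perturbed G v1 v2 t) Q j @[t --> at_infty R d]
    --> band_min (limit_graph G v1 v2 a) Qt j /\
  band_max (perturbed G v1 v2 t) Q j @[t --> at_infty R d]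
    --> band_max (limit_graph G v1 v2 a) Qt j.
Proof.
(* Both graphs reduce to the same function on the (d+1)-torus; the fundamental vertices of the limit
   graph lie in layer 0, where [Qt] takes the values of [Q]. *)
have bL : band (limit_graph G v1 v2 a) Qt j = model_band G v1 v2 Q j.
  by apply/funext => k; exact: band_limit.
have bP t : band (perturbed G v1 v2 t) Q j = model_band G v1 v2 Q j \o winding t.
  by apply/funext => k; exact: band_perturbed.
have cF := model_band_continuous hG (v1 := v1) (v2 := v2) (Q := Q) (j := j).
have pF := @model_band_periodic R d G v1 v2 Q j.
rewrite /band_min /band_max bL; split.
  under eq_fun do rewrite bP; exact: min_on_winding_cvg.
under eq_fun do rewrite bP; exact: max_on_winding_cvg.
Qed.
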